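(* Let $\boldsymbol{u}\in\{0,1\}^{\mathbb N}$. (i) $\phi(1\boldsymbol{u})=1^\infty$. (ii) If $\boldsymbol{u}\in\{0^\infty,1^\infty\}$, then $\phi(0\boldsymbol{u})=\boldsymbol{u}$. (iii) If $\boldsymbol{u}$ is a characteristic Sturmian sequence, then $\phi(0\boldsymbol{u})=1\boldsymbol{u}$. Furthermore, $1\boldsymbol{u}$ is the unique Sturmian sequence in $\{0,1\}^{\mathbb N}$ satisfying $0\boldsymbol{u}\le T^k(1\boldsymbol{u})\le 1\boldsymbol{u}$ for all $k\ge0$. (iv) If $\boldsymbol{u}$ is a characteristic periodic balanced sequence of rational slope $p/q\in(0,1)$ with $\gcd(p,q)=1$, then $\phi(0\boldsymbol{u})=\boldsymbol{s}'_{p/q,0}=(1w_{p,q}0)^\infty$. (v) If $\boldsymbol{u}$ is not of any of the forms in (ii)–(iv), then there exists a unique pair of coprime integers $p,q$ with $0<p<q$ such that $(w_{p,q}01)^\infty<\boldsymbol{u}<(w_{p,q}10)^\infty$, and then $\phi(0\boldsymbol{u})=\boldsymbol{s}'_{p/q,0}=(1w_{p,q}0)^\infty$. Moreover, in cases (iv) and (v), $\phi(0\boldsymbol{u})$ is the unique periodic balanced sequence in $\{0,1\}^{\mathbb N}$ satisfying $0\boldsymbol{u}\le T^k(\phi(0\boldsymbol{u}))\le\phi(0\boldsymbol{u})$ for all $k\ge0$.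
   Context: $\le$ denotes the lexicographic order on $\{0,1\}^{\mathbb N}$ induced by $0<1$; $T$ is the shift map $T((s_n)_{n\ge0})=(s_{n+1})_{n\ge0}$; $v^\infty=vvv\cdots$. For $\boldsymbol{x},\boldsymbol{y}\in\{0,1\}^{\mathbb N}$ let $\Sigma_{\boldsymbol{x},\boldsymbol{y}}=\{\boldsymbol{s}\in\{0,1\}^{\mathbb N}: \boldsymbol{x}\le T^k(\boldsymbol{s})\le\boldsymbol{y}\ \forall k\ge0\}$ and $\phi(\boldsymbol{x}):=\inf\{\boldsymbol{y}\in\{0,1\}^{\mathbb N}:\Sigma_{\boldsymbol{x},\boldsymbol{y}}\neq\emptyset\}$. For real $\alpha,\rho\in[0,1]$ define $\boldsymbol{s}_{\alpha,\rho}(n)=\lfloor(n+1)\alpha+\rho\rfloor-\lfloor n\alpha+\rho\rfloor$ and $\boldsymbol{s}'_{\alpha,\rho}(n)=\lceil(n+1)\alpha+\rho\rceil-\lceil n\alpha+\rho\rceil$ ($n\ge0$); these are Sturmian sequences of slope $\alpha$ if $\alpha$ is irrational and periodic balanced sequences if $\alpha$ is rational, and characteristic when $\alpha=\rho$. A characteristic Sturmian sequence is $\boldsymbol{s}_{\alpha,\alpha}=\boldsymbol{s}'_{\alpha,\alpha}$ with $\alpha\in(0,1)$ irrational. For coprime $0<p<q$, $w_{p,q}$ is the unique word of length $q-2$ with $\boldsymbol{s}_{p/q,0}=(0w_{p,q}1)^\infty$ and $\boldsymbol{s}'_{p/q,0}=(1w_{p,q}0)^\infty$ (the central word of slope $p/q$);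 the characteristic periodic balanced sequences of slope $p/q$ are $(w_{p,q}10)^\infty$ and $(w_{p,q}01)^\infty$.
   Formalization: Both uniqueness claims fail as worded (1^∞, larger slopes or shifts of f=φ(0u) also qualify); proved instead: a Sturmian/periodic balanced s with 0u≤T^k(s)≤f for all k has the slope of u (iii) or is a shift of f (iv, v), and s=f if also T^k(s)≤s for all k. *)

(* Defs.v *)
From HB Require Import structures.
From mathcomp Require Import all_boot all_order all_algebra.
From mathcomp Require Import boolp classical_sets reals.
From mathcomp Require Import zify ring lra.

Set Implicit Arguments.
Unset Strict Implicit.
Unset Printing Implicit Defensive.

Import Order.TTheory GRing.Theory Num.Theory.
Local Open Scope classical_set_scope.
Local Open Scope ring_scope.

(* {0,1}^N, with false = 0 and true = 1 *)
Definition binseq := nat -> bool.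

HB.instance Definition _ := gen_eqMixin binseq.
HB.instance Definition _ := gen_choiceMixin binseq.

Section Lexicographic.
Implicit Types x y z : binseq.

Definition lex_ltP x y : Prop :=
  exists n, (forall i, (i < n)%N -> x i = y i) /\ (x n < y n)%O.

Definition lex_lt : rel binseq := fun x y => `[< lex_ltP x y >].
Definition lex_le : rel binseq := fun x y => (x == y) || lex_lt x y.

Lemma lex_lt_def x y : lex_lt x y = (y != x) && lex_le x y.
Proof.
rewrite /lex_le (eq_sym x); case: eqVneq => //= ->.
by apply/asboolP => -[n [_]]; rewrite ltxx.
Qed.

Lemma lex_lt_trans : transitive lex_lt.
Proof.
move=> y x z /asboolP[n [xy hn]] /asboolP[m [yz hm]]; apply/asboolP.
have [nm|mn|e] := ltngtP n m.
- exists n; split=> [i lin|]; last by rewrite -yz.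
  by rewrite xy // yz // (ltn_trans lin).
- exists m; split=> [i lim|]; last by rewrite xy.
  by rewrite xy ?yz // (ltn_trans lim).
- subst m; exists n; split=> [i lin|]; first by rewrite xy ?yz.
  exact: lt_trans hn hm.
Qed.

Lemma lex_le_refl : reflexive lex_le.
Proof. by move=> x; rewrite /lex_le eqxx. Qed.

Lemma lex_le_anti : antisymmetric lex_le.
Proof.
move=> x y /andP[]; rewrite /lex_le; case: eqVneq => //= _ xy yx.
have := lex_lt_trans xy yx.
by rewrite lex_lt_def eqxx.
Qed.

Lemma lex_le_trans : transitive lex_le.
Proof.
move=> y x z /orP[/eqP->//|xy] /orP[/eqP<-|yz].
  by rewrite /lex_le xy orbT.
by rewrite /lex_le (lex_lt_trans xy yz) orbT.
Qed.

Lemma lex_le_total : total lex_le.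
Proof.
move=> x y; rewrite /lex_le; case: (eqVneq x y) => //= nxy.
have ex : exists n, x n != y n.
  apply/not_existsP => h; move/eqP: nxy; apply; apply/funext => n.
  by apply/eqP; move/negP: (h n); rewrite negbK.
have [n nn hmin] := ex_minnP ex.
have he i : (i < n)%N -> x i = y i.
  by move=> lin; apply/eqP; apply: contraTT lin => /hmin; rewrite -leqNgt.
have [h|h] : (x n < y n)%O \/ (y n < x n)%O.
  by case: (x n) (y n) nn => -[] //= _; [right|left].
- by apply/orP; left; apply/asboolP; exists n.
- apply/orP; right; apply/asboolP; exists n.
  by split=> // i /he.
Qed.

End Lexicographic.

Fact lex_display : Order.disp_t. Proof. exact: (Order.Disp tt tt). Qed.

HB.instance Definition _ := Order.isPOrder.Build lex_display binseq
  lex_lt_def lex_le_refl lex_le_anti lex_le_trans.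
HB.instance Definition _ :=
  Order.POrder_isTotal.Build lex_display binseq lex_le_total.

Definition shift (s : binseq) : binseq := fun n => s n.+1.

Definition bcons (b : bool) (s : binseq) : binseq :=
  fun n => if n is m.+1 then s m else b.

Definition bconst (b : bool) : binseq := fun=> b.

(* v^oo, for a nonempty word v *)
Definition per (v : seq bool) : binseq := fun n => nth false v (n %% size v)%N.

Definition Sigma (x y : binseq) : set binseq :=
  [set s | forall k, (x <= iter k shift s)%O /\ (iter k shift s <= y)%O].

(* The default value of [infimum] is irrelevant, see [phiP]. *)
Definition phi (x : binseq) : binseq :=
  infimum (bconst true) [set y | Sigma x y !=set0].

Lemma lex_ltE (x y : binseq) : (x < y)%O <-> lex_ltP x y.
Proof. by split=> /asboolP. Qed.

Lemma lex_top (x : binseq) : (x <= bconst true)%O.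
Proof.
rewrite leNgt; apply/negP => /lex_ltE[n [_]].
by rewrite /bconst; case: (x n).
Qed.

Lemma iter_shiftE k (s : binseq) n : iter k shift s n = s (k + n)%N.
Proof. by elim: k n => //= k IH n; rewrite /shift IH addnS. Qed.

Section Infimum.
Variable A : set binseq.

(* prefix of length n of the infimum of A *)
Fixpoint inf_prefix n : seq bool :=
  if n is m.+1 then
    let p := inf_prefix m in
    rcons p (~~ `[< exists2 x, A x & mkseq x m.+1 = rcons p false >])
  else [::].

Let z : binseq := fun n => nth false (inf_prefix n.+1) n.

Let size_ip n : size (inf_prefix n) = n.
Proof. by elim: n => //= n IH; rewrite size_rcons IH. Qed.

Let ipE n : inf_prefix n = mkseq z n.
Proof.
elim: n => // n IH; rewrite mkseqS -IH /z /=.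
by rewrite nth_rcons size_ip ltnn eqxx.
Qed.

Let zE n : z n = ~~ `[< exists2 x, A x & mkseq x n.+1 = rcons (mkseq z n) false >].
Proof. by rewrite {1}/z /= nth_rcons size_ip ltnn eqxx ipE. Qed.

Let mkseq_ext (x y : binseq) n :
  mkseq x n = mkseq y n <-> forall i, (i < n)%N -> x i = y i.
Proof.
split=> [h i lin|h].
  by rewrite -(nth_mkseq false x lin) h nth_mkseq.
by apply/eq_in_map => i; rewrite mem_iota => /andP[_ lin]; apply: h.
Qed.

Lemma infimums_lex : A !=set0 -> infimums A z.
Proof.
move=> A0; split=> [x Ax|y lby].
  rewrite leNgt; apply/negP => /lex_ltE[n [xz]].
  rewrite zE; case: asboolP => /=; first by case: (x n).
  move=> nex; case e: (x n) => // _; apply: nex; exists x => //.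
  by rewrite mkseqS e; congr rcons; apply/mkseq_ext.
have hpre n : exists2 x, A x & mkseq x n = mkseq z n.
  elim: n => [|n [x Ax e]]; first by case: A0 => x Ax; exists x.
  rewrite mkseqS zE; case: asboolP => //= nex; exists x => //.
  rewrite mkseqS e; congr rcons; apply/negPn/negP => /negbTE xn.
  by apply: nex; exists x; rewrite // mkseqS e xn.
rewrite leNgt; apply/negP => /lex_ltE[n [zy hn]].
have [x Ax /mkseq_ext e] := hpre n.+1.
have := lby _ Ax; rewrite leNgt => /negP; apply; apply/lex_ltE.
exists n; split=> [i lin|]; last by rewrite e.
by rewrite e ?zy // ltnS ltnW.
Qed.

End Infimum.

Lemma phiP x : infimums [set y | Sigma x y !=set0] (phi x).
Proof.
have ne : [set y | Sigma x y !=set0] !=set0.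
  exists (bconst true), (bconst true) => k; split; last exact: lex_top.
  suff -> : iter k shift (bconst true) = bconst true by exact: lex_top.
  by apply/funext => n; rewrite iter_shiftE.
rewrite /phi /infimum; case: ifPn => [/eqP e|_].
  by move: ne; rewrite e => -[].
by case: xgetP => [y _ //|/(_ _ (infimums_lex ne))].
Qed.

Section Mechanical.
Variable R : realType.
Implicit Types (a rho : R) (s u : binseq) (p q n : nat).

(* s_{a,rho} and s'_{a,rho}: for 0 <= a <= 1 the differences below lie in
   {0,1}, see [sturmE] and [sturm'E]. *)
Definition sturm a rho : binseq := fun n =>
  Num.floor (n.+1%:R * a + rho) - Num.floor (n%:R * a + rho) == 1.

Definition sturm' a rho : binseq := fun n =>
  Num.ceil (n.+1%:R * a + rho) - Num.ceil (n%:R * a + rho) == 1.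

Lemma sturmE a rho n : 0 <= a <= 1 ->
  Num.floor (n.+1%:R * a + rho) - Num.floor (n%:R * a + rho)
  = (sturm a rho n : nat)%:Z.
Proof.
move=> /andP[a0 a1]; rewrite /sturm.
set f := Num.floor (n.+1%:R * a + rho); set g := Num.floor (n%:R * a + rho).
have /andP[] := floor_itv (n.+1%:R * a + rho); rewrite -/f.
have /andP[] := floor_itv (n%:R * a + rho); rewrite -/g.
rewrite !intrD -natr1 => h1 h2 h3 h4.
have : (g%:~R < (f + 1)%:~R :> R) by rewrite intrD; lra.
have : (f%:~R < (g + 2)%:~R :> R) by rewrite intrD; lra.
rewrite !ltr_int => l1 l2.
have : f - g = 0 \/ f - g = 1 by lia.
by case=> ->.
Qed.

Lemma sturm'E a rho n : 0 <= a <= 1 ->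
  Num.ceil (n.+1%:R * a + rho) - Num.ceil (n%:R * a + rho)
  = (sturm' a rho n : nat)%:Z.
Proof.
move=> /andP[a0 a1]; rewrite /sturm'.
set f := Num.ceil (n.+1%:R * a + rho); set g := Num.ceil (n%:R * a + rho).
have /andP[] := ceil_itv (n.+1%:R * a + rho); rewrite -/f.
have /andP[] := ceil_itv (n%:R * a + rho); rewrite -/g.
rewrite !intrD -natr1 => h1 h2 h3 h4.
have : (g%:~R < (f + 1)%:~R :> R) by rewrite intrD; lra.
have : (f%:~R < (g + 2)%:~R :> R) by rewrite intrD; lra.
rewrite !ltr_int => l1 l2.
have : f - g = 0 \/ f - g = 1 by lia.
by case=> ->.
Qed.

Definition has_slope a s : Prop :=
  0 <= a <= 1 /\
  exists2 rho, 0 <= rho <= 1 & s = sturm a rho \/ s = sturm' a rho.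

Definition sturmian s : Prop := exists2 a, irrational a & has_slope a s.

Definition periodic_balanced s : Prop := exists2 a, rational a & has_slope a s.

Definition char_sturmian s : Prop :=
  exists2 a, 0 < a < 1 /\ irrational a & s = sturm a a.

Definition slope_pair p q : Prop := [/\ (0 < p)%N, (p < q)%N & coprime p q].

(* The central word w_{p,q}: s_{p/q,0} stripped of its first letter, cut at
   length q - 2; [centralP] gives its characterization. *)
Definition central p q : seq bool :=
  mkseq (fun i => sturm (p%:R / q%:R) 0 i.+1) (q - 2).

Definition char_periodic p q s : Prop :=
  slope_pair p q /\
  (s = per (central p q ++ [:: true; false]) \/
   s = per (central p q ++ [:: false; true])).

Definition generic u : Prop :=
  [/\ u <> bconst false, u <> bconst true, ~ char_sturmian u &
      ~ exists p q, char_periodic p q u].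

Definition in_gap p q u : Prop :=
  slope_pair p q /\
  (per (central p q ++ [:: false; true]) < u)%O /\
  (u < per (central p q ++ [:: true; false]))%O.

Section CentralWord.
Variables p q : nat.
Hypothesis hpq : slope_pair p q.
Local Notation a := (p%:R / q%:R : R).

Let q0 : (0 < q)%N. Proof. by case: hpq => ? ? _; lia. Qed.
Let q0R : (0 : R) < q%:R. Proof. by rewrite ltr0n. Qed.

Let floorE n : Num.floor (n%:R * a + 0) = (n * p %/ q)%N :> int.
Proof.
apply: floor_def; rewrite addr0 mulrA -natrM.
rewrite ler_pdivlMr // ltr_pdivrMr // intrD -!pmulrn -natrM natr1 -natrM.
by rewrite ler_nat ltr_nat leq_trunc_div /= mulnC ltn_ceil.
Qed.

Let ceilE n : Num.ceil (n%:R * a + 0) = ((n * p + q.-1) %/ q)%N :> int.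
Proof.
have := leq_trunc_div (n * p + q.-1) q.
have := ltn_ceil (n * p + q.-1) q0.
set m := (_ %/ q)%N => h1 h2; apply: ceil_def; rewrite addr0 mulrA -natrM.
rewrite ltr_pdivlMr // ler_pdivrMr // intrD -!pmulrn -natrM ler_nat.
rewrite mulrDl mulN1r -natrM ltrBlDr -natrD ltr_nat.
by apply/andP; split; lia.
Qed.

Let divS m : ((m %/ q).+1 = (m + q) %/ q)%N.
Proof. by rewrite divnDr ?dvdnn // divnn q0 addn1. Qed.

Let sturmN n : sturm a 0 n = (n.+1 * p %/ q != n * p %/ q)%N.
Proof.
have /andP[] : (n * p %/ q <= n.+1 * p %/ q)%N && (n.+1 * p %/ q <= (n * p %/ q).+1)%N.
  have [_ pq _] := hpq.
  by rewrite divS !leq_div2r //; lia.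
by rewrite /sturm !floorE; lia.
Qed.

Let sturm'N n :
  sturm' a 0 n = ((n.+1 * p + q.-1) %/ q != (n * p + q.-1) %/ q)%N.
Proof.
have /andP[] : ((n * p + q.-1) %/ q <= (n.+1 * p + q.-1) %/ q)%N &&
   ((n.+1 * p + q.-1) %/ q <= ((n * p + q.-1) %/ q).+1)%N.
  have [_ pq _] := hpq.
  by rewrite divS !leq_div2r //; lia.
by rewrite /sturm' !ceilE; lia.
Qed.

Let sturm_mod n : sturm a 0 n = sturm a 0 (n %% q)%N.
Proof.
rewrite !sturmN {1 2}(divn_eq n q) -addnS !mulnDl.
by rewrite mulnAC !divnMDl // eqn_add2l.
Qed.

Let sturm'_mod n : sturm' a 0 n = sturm' a 0 (n %% q)%N.
Proof.
rewrite !sturm'N {1 2}(divn_eq n q) -addnS !mulnDl -!addnA.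
by rewrite mulnAC !divnMDl // eqn_add2l.
Qed.

Let ceil_floor n : (0 < n < q)%N ->
  ((n * p + q.-1) %/ q = (n * p %/ q).+1)%N.
Proof.
move=> /andP[n0 nq]; have [_ _ cpq] := hpq.
have nd : ~~ (q %| n * p)%N.
  rewrite Gauss_dvdl 1?coprime_sym //; apply/negP => /dvdn_leq; lia.
rewrite {1}(divn_eq (n * p) q) -addnA divnMDl // -addn1; congr addn.
have := ltn_pmod (n * p) q0; move: nd; rewrite /dvdn => nd lm.
have -> : ((n * p) %% q + q.-1 = 1 * q + ((n * p) %% q).-1)%N by lia.
by rewrite divnMDl // divn_small //; lia.
Qed.

Lemma size_central : size (central p q) = (q - 2)%N.
Proof. by rewrite size_mkseq. Qed.

Let q2 : (2 <= q)%N. Proof. by case: hpq => ? ? _; lia. Qed.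

Lemma central_lower : sturm a 0 = per (false :: central p q ++ [:: true]).
Proof.
have [p0 pq cpq] := hpq.
apply/funext => n; rewrite /per /= size_cat size_central /=.
have -> : ((q - 2 + 1).+1 = q)%N by lia.
rewrite sturm_mod; have := ltn_pmod n q0; move: (n %% q)%N => [|m] lm /=.
  by rewrite sturmN mul0n mul1n div0n divn_small.
rewrite nth_cat size_central; case: ltnP => h; first by rewrite nth_mkseq.
have -> : (m - (q - 2) = 0)%N by lia.
have -> : m.+1 = q.-1 by lia.
rewrite sturmN prednK // mulKn // /=.
suff: (q.-1 * p %/ q < p)%N by move=> h'; rewrite gtn_eqF.
by rewrite ltn_divLR // mulnC ltn_mul2l p0 prednK //=.
Qed.

Lemma central_upper : sturm' a 0 = per (true :: central p q ++ [:: false]).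
Proof.
have [p0 pq cpq] := hpq.
apply/funext => n; rewrite /per /= size_cat size_central /=.
have -> : ((q - 2 + 1).+1 = q)%N by lia.
rewrite sturm'_mod; have := ltn_pmod n q0; move: (n %% q)%N => [|m] lm /=.
  rewrite sturm'N mul0n add0n [(q.-1 %/ q)%N]divn_small ?prednK //.
  by rewrite ceil_floor ?ltn0Sn //; lia.
rewrite nth_cat size_central; case: ltnP => h.
  by rewrite nth_mkseq // sturm'N sturmN !ceil_floor ?eqSS //; lia.
have -> : (m - (q - 2) = 0)%N by lia.
rewrite /= sturm'N; apply/negbTE; rewrite negbK (@ceil_floor m.+1); last lia.
have -> : m.+1 = q.-1 by lia.
rewrite prednK // [(q * p)%N]mulnC divnMDl // [(q.-1 %/ q)%N]divn_small ?prednK //.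
have -> : (q.-1 * p = p.-1 * q + (q - p))%N.
  by move: p0 pq; clear; case: p q => [|p'] [|q'] //= _; nia.
by rewrite divnMDl // [((q - p) %/ q)%N]divn_small; lia.
Qed.

Lemma centralP w : size w = (q - 2)%N /\
    sturm a 0 = per (false :: w ++ [:: true]) /\
    sturm' a 0 = per (true :: w ++ [:: false])
  <-> w = central p q.
Proof.
split=> [[sw [lw _]]|->]; last first.
  by rewrite size_central -central_lower -central_upper.
apply: (@eq_from_nth _ false); first by rewrite size_central.
move=> i; rewrite sw => hi; rewrite nth_mkseq // lw /per /= size_cat sw /=.
by rewrite modn_small ?nth_cat /= ?nth_cat ?sw ?hi //; lia.
Qed.

Let sturm_shift n : sturm a a n = sturm a 0 n.+1.
Proof. by rewrite /sturm !addr0 -!natr1 !mulrDl !mul1r. Qed.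

Let sturm'_shift n : sturm' a a n = sturm' a 0 n.+1.
Proof. by rewrite /sturm' !addr0 -!natr1 !mulrDl !mul1r. Qed.

Let per_shift b w n : per (b :: w) n.+1 = per (rcons w b) n.
Proof.
rewrite /per size_rcons /=.
have := ltn_pmod n (ltn0Sn (size w)).
rewrite -[in nth _ _ _](addn1 n) -modnDml leq_eqVlt => /orP[/eqP [e]|].
  by rewrite e addn1 modnn nth_rcons ltnn eqxx.
by rewrite ltnS => h; rewrite addn1 modn_small //= nth_rcons h.
Qed.

Lemma char_periodicE s :
  char_periodic p q s <-> s = sturm a a \/ s = sturm' a a.
Proof.
have -> : sturm a a = per (central p q ++ [:: true; false]).
  apply/funext => n; rewrite sturm_shift central_lower per_shift.
  by rewrite -cats1 -catA.
have -> : sturm' a a = per (central p q ++ [:: false; true]).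
  apply/funext => n; rewrite sturm'_shift central_upper per_shift.
  by rewrite -cats1 -catA.
by split=> [[]//|h]; split.
Qed.

End CentralWord.
End Mechanical.

(* Main.v *)
Require Import Defs.
From HB Require Import structures.
From mathcomp Require Import all_boot all_order all_algebra.
From mathcomp Require Import boolp classical_sets reals.
From mathcomp Require Import zify ring lra.

Set Implicit Arguments.
Unset Strict Implicit.
Unset Printing Implicit Defensive.

Import Order.TTheory GRing.Theory Num.Theory.
Local Open Scope ring_scope.

(** Measure a sequence [s] against a slope [a] by its discrepancy, the number of
    ones among the first [n] letters minus [n a].  Say that [u] has
    characteristic slope [a] if [0 u <= sturm a 0] and [sturm' a 0 <= 1 u].

    Let [u] have characteristic slope [a].  If all shifts of [s] are at least
    [0 u], then cutting [s] whenever it rises above this bound shows that its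
    discrepancy at slope [a] is at least [-1]; if all shifts are at most [1 u],
    it is at most [1], by the symmetry exchanging 0 with 1 and [a] with [1 - a].
    A discrepancy bounded below at slope [a] and above at slope [b] forces
    [a <= b].  Since [a |-> sturm' a 0] is semicontinuous, an upper bound
    [y < sturm' a 0] on the shifts would already be less than [sturm' b 0] for
    some [b < a], so [phi (0 u) = sturm' a 0], and the same comparison makes the
    slope unique.

    Every [u] has a characteristic slope, the supremum of the [b] with
    [sturm' b 0 <= 1 u].  It is 0 or 1 exactly for the constant sequences; if it
    is irrational, then [u = sturm a a], and if it is a proper fraction [p / q],
    then [u] is in the interval whose ends are the two characteristic periodic
    balanced sequences of slope [p / q]. *)

Section BinarySequences.
Implicit Types (x y s : binseq) (b : bool).

Lemma lex_lt_first_diffP x y :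
  reflect (exists n, [/\ forall i, (i < n)%N -> x i = y i,
                         x n = false & y n = true])
          (x < y)%O.
Proof.
apply: (iffP idP) => [/lex_ltE[n [xy xyn]]|[n [xy xn yn]]].
  by exists n; move: xyn; case: (x n) (y n) => -[].
by apply/lex_ltE; exists n; rewrite xn yn.
Qed.

Lemma lex_bot s : (bconst false <= s)%O.
Proof. by rewrite leNgt; apply/negP => /lex_lt_first_diffP[n []]. Qed.

Lemma bcons_shift s : bcons (s 0%N) (shift s) = s.
Proof. by apply/funext => -[]. Qed.

Lemma bcons_bconst b : bcons b (bconst b) = bconst b.
Proof. by apply/funext => -[]. Qed.

Lemma bcons_lt b x y : (bcons b x < bcons b y)%O = (x < y)%O.
Proof.
apply/lex_lt_first_diffP/lex_lt_first_diffP => -[n [xy xn yn]].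
  case: n xy xn yn => [_ /= -> //|n] xy xn yn.
  by exists n; split=> // i i_lt_n; apply: (xy i.+1).
by exists n.+1; split=> // -[//|i] i_lt_n; apply: xy.
Qed.

Lemma bcons_le b x y : (bcons b x <= bcons b y)%O = (x <= y)%O.
Proof. by rewrite !leNgt bcons_lt. Qed.

Lemma shift_per b (w : seq bool) : shift (per (b :: w)) = per (rcons w b).
Proof.
apply/funext => n; rewrite /shift /per size_rcons /=.
have := ltn_pmod n (ltn0Sn (size w)).
rewrite -[in nth _ _ _](addn1 n) -modnDml leq_eqVlt => /orP[/eqP[->]|].
  by rewrite addn1 modnn nth_rcons ltnn eqxx.
by rewrite ltnS => n_lt; rewrite addn1 modn_small //= nth_rcons n_lt.
Qed.

Lemma periodic_max_shift s q : (0 < q)%N -> iter q shift s = s ->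
  exists2 i, (i < q)%N & forall k, (iter k shift s <= iter i shift s)%O.
Proof.
move=> q0 s_per.
have [i _ i_max] :=
  arg_maxP (fun i : 'I_q => iter i shift s) (erefl (xpredT (Ordinal q0))).
exists i => // k; rewrite (divn_eq k q) addnC iterD.
suff -> : iter (k %/ q * q) shift s = s by apply: (i_max (Ordinal (ltn_pmod k q0))).
by elim: (k %/ q)%N => // m IHm; rewrite mulSn iterD IHm.
Qed.

Definition flip s : binseq := fun n => ~~ s n.

Lemma flipK : involutive flip.
Proof. by move=> s; apply/funext => n; rewrite /flip negbK. Qed.

Lemma flip_bcons b s : flip (bcons b s) = bcons (~~ b) (flip s).
Proof. by apply/funext => -[]. Qed.

Lemma flip_iter_shift k s : flip (iter k shift s) = iter k shift (flip s).
Proof. by apply/funext => n; rewrite /flip !iter_shiftE. Qed.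

Lemma flip_lt x y : (flip x < flip y)%O = (y < x)%O.
Proof.
have flip_anti z t : (z < t)%O -> (flip t < flip z)%O.
  move=> /lex_lt_first_diffP[n [zt zn tn]]; apply/lex_lt_first_diffP; exists n.
  by rewrite /flip zn tn; split=> // i /zt ->.
by apply/idP/idP => /flip_anti; rewrite ?flipK.
Qed.

Lemma flip_le x y : (flip x <= flip y)%O = (y <= x)%O.
Proof. by rewrite !leNgt flip_lt. Qed.

End BinarySequences.

Section Discrepancy.
Variable R : comNzRingType.
Implicit Types (a b : R) (x y s : binseq) (k n : nat).

Definition discrepancy a s n : R := \sum_(i < n) ((s i)%:R - a).

Lemma discrepancy0 a s : discrepancy a s 0 = 0.
Proof. by rewrite /discrepancy big_ord0. Qed.

Lemma discrepancyS a s n :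
  discrepancy a s n.+1 = discrepancy a s n + ((s n)%:R - a).
Proof. by rewrite /discrepancy big_ord_recr. Qed.

Lemma discrepancy_bcons a (b : bool) s n :
  discrepancy a (bcons b s) n.+1 = b%:R - a + discrepancy a s n.
Proof. by rewrite /discrepancy big_ord_recl. Qed.

Lemma discrepancyD a s k n :
  discrepancy a s (k + n) = discrepancy a s k + discrepancy a (iter k shift s) n.
Proof.
elim: n => [|n IHn]; first by rewrite addn0 discrepancy0 addr0.
by rewrite addnS !discrepancyS IHn iter_shiftE -!addrA.
Qed.

Lemma discrepancy_flip a s n :
  discrepancy (1 - a) (flip s) n = - discrepancy a s n.
Proof.
rewrite /discrepancy -sumrN; apply: eq_bigr => i _.
by rewrite /flip; case: (s i) => /=; ring.
Qed.

Lemma discrepancy_slope a b s n :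
  discrepancy b s n = discrepancy a s n + n%:R * (a - b).
Proof.
elim: n => [|n IHn]; first by rewrite !discrepancy0 mul0r addr0.
by rewrite !discrepancyS IHn -natr1; ring.
Qed.

Lemma eq_discrepancy a x y n :
  (forall i, (i < n)%N -> x i = y i) -> discrepancy a x n = discrepancy a y n.
Proof. by move=> xy; apply: eq_bigr => i _; rewrite xy. Qed.

Lemma lex_lt_discrepancy_step a x y : (x < y)%O ->
  exists2 n, (forall i, (i <= n)%N -> discrepancy a x i = discrepancy a y i)
           & discrepancy a y n.+1 = discrepancy a x n.+1 + 1.
Proof.
move=> /lex_lt_first_diffP[n [xy xn yn]]; have eq_disc i : (i <= n)%N ->
    discrepancy a x i = discrepancy a y i.
  by move=> i_le_n; apply: eq_discrepancy => j j_lt_i; apply/xy/(leq_trans j_lt_i).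
by exists n; rewrite // !discrepancyS eq_disc // xn yn /=; ring.
Qed.

End Discrepancy.

Section DiscrepancyOrder.
Variable R : realDomainType.
Implicit Types (a : R) (x y z s u : binseq).

Lemma discrepancy_lex_le a x y :
  (forall n, discrepancy a x n < discrepancy a y n + 1) -> (x <= y)%O.
Proof.
move=> xy; rewrite leNgt; apply/negP => /(lex_lt_discrepancy_step a)[n _ step].
by have := xy n.+1; rewrite step ltxx.
Qed.

Lemma discrepancy_lex_lt a x y N :
  (forall n, (n < N)%N -> discrepancy a x n < discrepancy a y n + 1) ->
  discrepancy a x N < discrepancy a y N -> (x < y)%O.
Proof.
move=> xy xyN; rewrite ltNge; apply/negP; rewrite le_eqVlt => /orP[/eqP yx|].
  by rewrite yx ltxx in xyN.
move=> /(lex_lt_discrepancy_step a)[n eq_disc step].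
have [n_lt_N|N_le_n|N_eq] := ltngtP n.+1 N.
- by have := xy _ n_lt_N; rewrite step ltxx.
- by move: xyN; rewrite eq_disc ?ltxx.
- by move: xyN; rewrite -N_eq step; lra.
Qed.

(* Any stretch on which [s] stays above [bcons false u] either follows [z] or
   can be cut right after it rises above [z]; the discrepancy does not decrease
   over the part cut off. *)
Lemma discrepancy_ge_lower_bound a z u s : a <= 1 ->
  (forall n, 0 <= discrepancy a z n) -> (z <= bcons true u)%O ->
  (forall k, bcons false u <= iter k shift s)%O ->
  forall n, -1 <= discrepancy a s n.
Proof.
move=> a1 z_ge0 z_le_u s_ge n; elim/ltn_ind: n s s_ge => n IHn s s_ge.
have cut m : (0 < m <= n)%N -> 0 <= discrepancy a s m -> -1 <= discrepancy a s n.
  move=> /andP[m0 mn] s_m; rewrite -(subnKC mn) discrepancyD.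
  suff : -1 <= discrepancy a (iter m shift s) (n - m) by lra.
  by apply: IHn => [|k]; [lia | rewrite -iterD].
case: n IHn cut => [_ _|n IHn cut]; first by rewrite discrepancy0; lra.
have [s0|/negbTE s0] := boolP (s 0%N).
  by apply: (cut 1%N) => //; rewrite discrepancyS discrepancy0 s0 /=; lra.
have s_disc m :
    discrepancy a s m.+1 = discrepancy a (bcons true (shift s)) m.+1 - 1.
  by rewrite -[in LHS](bcons_shift s) s0 !discrepancy_bcons /=; ring.
have : (z <= bcons true (shift s))%O.
  apply: le_trans z_le_u _; rewrite bcons_le -(bcons_le false) -{2}s0 bcons_shift.
  exact: s_ge 0%N.
rewrite le_eqVlt => /orP[/eqP z_eq|/(lex_lt_discrepancy_step a)[m z_eq step]].
  by rewrite s_disc -z_eq; have := z_ge0 n.+1; lra.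
have [m_lt_n|n_le_m] := ltnP n m.
  by rewrite s_disc -z_eq //; have := z_ge0 n.+1; lra.
by apply: (cut m.+1); rewrite ?ltnS // s_disc step; have := z_ge0 m.+1; lra.
Qed.

End DiscrepancyOrder.

Lemma discrepancy_slope_le (R : archiRealFieldType) (a b c d : R) (s : binseq) :
  (forall n, c <= discrepancy a s n) -> (forall n, discrepancy b s n <= d) ->
  a <= b.
Proof.
move=> ge_c le_d; rewrite leNgt -subr_gt0; apply/negP => ab.
have cd n : n%:R * (a - b) <= d - c.
  by have := ge_c n; have := le_d n; rewrite (discrepancy_slope a b); lra.
have dc0 : 0 <= d - c by have := cd 0%N; rewrite mul0r.
have := archi_boundP (divr_ge0 dc0 (ltW ab)).
by rewrite ltr_pdivrMr // ltNge cd.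
Qed.

Section MechanicalSequences.
Variable R : realType.
Implicit Types (a b rho : R) (s u y : binseq) (n k : nat).

Lemma sturm_bool (b : bool) : sturm (b%:R : R) 0 = bconst b.
Proof.
apply/funext => n; rewrite /sturm /bconst; case: b; rewrite ?mulr0 ?subrr //.
by rewrite !mulr1 !addr0 !pmulrn !intrKfloor -addn1 PoszD addrC addKr.
Qed.

Lemma discrepancy_sturm a rho n : 0 <= a <= 1 ->
  discrepancy a (sturm a rho) n
  = (Num.floor (n%:R * a + rho) - Num.floor rho)%:~R - n%:R * a.
Proof.
move=> a01; elim: n => [|n IHn].
  by rewrite discrepancy0 mul0r add0r subrr subr0.
rewrite discrepancyS IHn [(nat_of_bool _)%:R]pmulrn -sturmE //.
by rewrite !intrB -!natr1; ring.
Qed.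

Lemma discrepancy_sturm_lt a rho m n : 0 <= a <= 1 ->
  discrepancy a (sturm a rho) m < discrepancy a (sturm a rho) n + 1.
Proof.
move=> a01; rewrite !discrepancy_sturm // !intrB.
have /andP[] := floor_itv (m%:R * a + rho).
have /andP[] := floor_itv (n%:R * a + rho).
by rewrite !intrD; lra.
Qed.

Lemma discrepancy_sturm0 a n : 0 <= a <= 1 ->
  -1 < discrepancy a (sturm a 0) n <= 0.
Proof.
move=> a01; rewrite discrepancy_sturm // addr0 floor0 subr0.
have /andP[] := floor_itv (n%:R * a).
by rewrite intrD; lra.
Qed.

(* The symmetry [s |-> flip s], [a |-> 1 - a] exchanges the lower and the upper
   sequences, since ceil (n (1 - a) - rho) = n - floor (n a + rho). *)
Lemma sturm'_flip a rho (m : int) : 0 <= a <= 1 ->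
  sturm' a rho = flip (sturm (1 - a) (m%:~R - rho)).
Proof.
move=> a01; have a01' : 0 <= 1 - a <= 1 by lra.
apply/funext => n; rewrite /flip /sturm'.
have ceilE k : Num.ceil (k%:R * a + rho)
    = k%:Z + m - Num.floor (k%:R * (1 - a) + (m%:~R - rho)).
  have -> : k%:R * (1 - a) + (m%:~R - rho) = - (k%:R * a + rho) + (k%:Z + m)%:~R.
    by rewrite intrD -pmulrn; ring.
  by rewrite floorDrz ?intr_int // intrKfloor ceilNfloor; ring.
rewrite !ceilE; have := sturmE (m%:~R - rho) n a01'.
move: (Num.floor _) (Num.floor _) => f g.
by case: (sturm _ _ n) => /= floor_step; [apply/negbTE/eqP | apply/eqP]; lia.
Qed.

Lemma sturm'0_flip a : 0 <= a <= 1 -> sturm' a 0 = flip (sturm (1 - a) 0).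
Proof. by move=> a01; rewrite (sturm'_flip 0 0) // subr0. Qed.

Lemma sturm'_char_flip a : 0 <= a <= 1 -> sturm' a a = flip (sturm (1 - a) (1 - a)).
Proof. exact: (sturm'_flip a 1). Qed.

Lemma sturm'_bool (b : bool) : sturm' (b%:R : R) 0 = bconst b.
Proof.
rewrite sturm'0_flip ?ler0n ?lern1 ?leq_b1 //.
have -> : 1 - b%:R = (~~ b)%:R :> R by case: b => /=; ring.
by rewrite sturm_bool; apply/funext => n; rewrite /flip /bconst negbK.
Qed.

Lemma discrepancy_sturm'0 a n : 0 <= a <= 1 ->
  0 <= discrepancy a (sturm' a 0) n < 1.
Proof.
move=> a01; rewrite sturm'0_flip // -{1 3}(subKr 1 a) discrepancy_flip.
by have := @discrepancy_sturm0 (1 - a) n; lra.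
Qed.

Lemma has_slope_discrepancy a s m n : has_slope a s ->
  discrepancy a s m < discrepancy a s n + 1.
Proof.
move=> [a01 [rho _ [->|->]]]; first exact: discrepancy_sturm_lt.
rewrite (sturm'_flip rho 0) // -{1 3}(subKr 1 a) !discrepancy_flip.
by have := @discrepancy_sturm_lt (1 - a) (0 - rho) n m; lra.
Qed.

Lemma sturm0_le_has_slope a s k : has_slope a s ->
  (sturm a 0 <= iter k shift s)%O.
Proof.
move=> slope_s; have [a01 _] := slope_s.
apply: (discrepancy_lex_le (a := a)) => n.
have := has_slope_discrepancy k (k + n) slope_s; rewrite discrepancyD.
by have := discrepancy_sturm0 n a01; lra.
Qed.

Lemma has_slope_le_sturm'0 a s k : has_slope a s ->
  (iter k shift s <= sturm' a 0)%O.
Proof.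
move=> slope_s; have [a01 _] := slope_s.
apply: (discrepancy_lex_le (a := a)) => n.
have := has_slope_discrepancy (k + n) k slope_s; rewrite discrepancyD.
by have := discrepancy_sturm'0 n a01; lra.
Qed.

Lemma has_slope_sturm_char a : 0 <= a <= 1 -> has_slope a (sturm a a).
Proof. by move=> a01; split=> //; exists a => //; left. Qed.

Lemma has_slope_sturm'0 a : 0 <= a <= 1 -> has_slope a (sturm' a 0).
Proof. by move=> a01; split=> //; exists 0; [rewrite lexx ler01|right]. Qed.

Lemma has_slope_periodic a q s : q%:R * a \is a Num.int ->
  has_slope a s -> iter q shift s = s.
Proof.
move=> qa_int [_ [rho _ s_def]]; apply/funext => n; rewrite iter_shiftE.
have qE k : (q + k)%:R * a + rho = k%:R * a + rho + q%:R * a.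
  by rewrite natrD; ring.
case: s_def => ->; rewrite /sturm /sturm' -addnS !qE.
  by rewrite !(floorDrz _ qa_int) opprD addrACA subrr addr0.
by rewrite !(ceilDrz _ qa_int) opprD addrACA subrr addr0.
Qed.

Lemma sturm0_bcons a : 0 <= a < 1 -> sturm a 0 = bcons false (sturm a a).
Proof.
move=> a01; apply/funext => -[|n] /=; rewrite /sturm.
  by rewrite mul0r !addr0 mul1r floor0 subr0 (@floor_def _ a 0) // addr0.
by rewrite !addr0 -!natr1 !mulrDl !mul1r.
Qed.

Lemma sturm'0_bcons a : 0 < a <= 1 -> sturm' a 0 = bcons true (sturm' a a).
Proof.
move=> a01; rewrite sturm'0_flip ?sturm'_char_flip; [|lra|lra].
by rewrite sturm0_bcons ?flip_bcons //; lra.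
Qed.

Lemma sturm'0_homo a b : 0 <= a -> a <= b -> b <= 1 -> (sturm' a 0 <= sturm' b 0)%O.
Proof.
move=> a0 ab b1; apply: (discrepancy_lex_le (a := b)) => n.
rewrite (discrepancy_slope a b).
have a01 : 0 <= a <= 1 by lra.
have b01 : 0 <= b <= 1 by lra.
have := discrepancy_sturm'0 n a01; have := discrepancy_sturm'0 n b01.
have : n%:R * (a - b) <= 0 by rewrite mulr_ge0_le0 ?subr_le0.
by lra.
Qed.

(* Only the finitely many inequalities n b < floor (n a) + 1 up to the first
   difference matter, and they are open conditions on b. *)
Lemma sturm0_lt_right a y : 0 <= a <= 1 -> (sturm a 0 < y)%O ->
  exists2 b, a < b < 1 & (sturm b 0 < y)%O.
Proof.
move=> a01 lt_y; have a1 : a < 1.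
  rewrite lt_neqAle andbC; case/andP: a01 => _ -> /=; apply/eqP => aE.
  by move: lt_y; rewrite aE (sturm_bool true) ltNge lex_top.
have [N eq_disc step] := lex_lt_discrepancy_step a lt_y.
pose margin i := (1 + discrepancy a (sturm a 0) i.+1) / i.+1%:R.
pose e := \big[Num.min/1 - a]_(i < N.+1) margin i.
have e_gt0 : 0 < e.
  apply/bigmin_gtP; split=> [|i _]; first by lra.
  by rewrite divr_gt0 ?ltr0n //; have := discrepancy_sturm0 i.+1 a01; lra.
have e_le : e <= 1 - a by apply: bigmin_le_id.
pose b := a + e / 2; have b01 : 0 <= b <= 1 by rewrite /b; lra.
have lt_disc n : (n <= N.+1)%N ->
    discrepancy b (sturm b 0) n < discrepancy b (sturm a 0) n + 1.
  case: n => [|n] n_le; first by rewrite !discrepancy0; lra.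
  have /andP[_ b_le0] := discrepancy_sturm0 n.+1 b01.
  suff : 0 < discrepancy b (sturm a 0) n.+1 + 1 by lra.
  have : e <= margin n by apply: (bigmin_le _ (Ordinal n_le)).
  rewrite (discrepancy_slope a b) ler_pdivlMr ?ltr0n // /b => e_margin.
  by have : 0 < e * n.+1%:R; [rewrite mulr_gt0 ?ltr0n | lra].
exists b; first by rewrite /b; lra.
apply: (discrepancy_lex_lt (a := b) (N := N.+1)) => [n n_le|].
  rewrite [discrepancy b y n](discrepancy_slope a b) -eq_disc //.
  by rewrite -discrepancy_slope lt_disc // ltnW.
rewrite [discrepancy b y _](discrepancy_slope a b) step.
by have := lt_disc _ (leqnn _); rewrite (discrepancy_slope a b (sturm a 0)); lra.
Qed.

Lemma lt_sturm'0_left a y : 0 <= a <= 1 -> (y < sturm' a 0)%O ->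
  exists2 b, 0 < b < a & (y < sturm' b 0)%O.
Proof.
move=> a01; rewrite sturm'0_flip // -(flipK y) flip_lt.
move=> /sturm0_lt_right[|b b_itv lt_y]; first lra.
exists (1 - b); first by lra.
by rewrite sturm'0_flip ?subKr ?flip_lt //; lra.
Qed.

End MechanicalSequences.

Section Phi.
Implicit Types (x y s u : binseq).

Lemma phi_le x y s : Sigma x y s -> (phi x <= y)%O.
Proof. by move=> s_in; have [lb _] := phiP x; apply: lb; exists s. Qed.

Lemma le_phi x z : (forall y s, Sigma x y s -> (z <= y)%O) -> (z <= phi x)%O.
Proof. by move=> z_lb; have [_ glb] := phiP x; apply: glb => y [s /z_lb]. Qed.

Lemma Sigma_phi_max x s :
  Sigma x (phi x) s -> (forall k, iter k shift s <= s)%O -> s = phi x.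
Proof.
move=> s_in s_max; apply/eqP; rewrite eq_le (s_in 0%N).2 /=.
by apply: (phi_le (s := s)) => k; rewrite s_max (s_in k).1.
Qed.

Lemma Sigma_phi_periodic x s q : (0 < q)%N -> iter q shift s = s ->
  Sigma x (phi x) s -> exists j, s = iter j shift (phi x).
Proof.
move=> q0 s_per s_in; have [i i_lt_q i_max] := periodic_max_shift q0 s_per.
exists (q - i)%N; rewrite -(Sigma_phi_max (s := iter i shift s)).
- by rewrite -iterD subnK // ltnW.
- by move=> k; rewrite -iterD.
- by move=> k; rewrite -iterD.
Qed.

Lemma phi_bcons_true u : phi (bcons true u) = bconst true.
Proof.
apply/eqP; rewrite eq_le lex_top; apply: le_phi => y s s_in.
suff <- : s = bconst true by apply: (s_in 0%N).2.
apply/funext => n; apply/negPn/negP => /negbTE sn; have [+ _] := s_in n.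
rewrite leNgt => /negP; apply; apply/lex_lt_first_diffP; exists 0%N.
by rewrite iter_shiftE addn0.
Qed.

End Phi.

Section CharacteristicSlope.
Variable R : realType.
Implicit Types (a b : R) (s u y : binseq).

(* For [0 < a < 1] this says [sturm' a a <= u <= sturm a a], see [char_slopeP];
   in this form the constant sequences also have a slope, 0 or 1. *)
Definition char_slope a u : Prop :=
  [/\ 0 <= a <= 1, (bcons false u <= sturm a 0)%O
    & (sturm' a 0 <= bcons true u)%O].

Lemma char_slope_flip a u : char_slope a u -> char_slope (1 - a) (flip u).
Proof.
move=> [a01 le_sturm sturm'_le]; split; first lra.
  by rewrite -(flip_bcons true) -(flipK (sturm _ _)) -sturm'0_flip ?flip_le.
rewrite sturm'0_flip ?subKr; last lra.
by rewrite -(flip_bcons false) flip_le.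
Qed.

Lemma char_slopeP a u : 0 < a < 1 ->
  char_slope a u <-> (sturm' a a <= u)%O /\ (u <= sturm a a)%O.
Proof.
move=> a01; rewrite /char_slope sturm0_bcons ?sturm'0_bcons ?bcons_le; [|lra|lra].
by split=> [[]|[]] //; split=> //; lra.
Qed.

Lemma char_slope_bconst (b : bool) : char_slope b%:R (bconst b).
Proof.
rewrite /char_slope sturm_bool sturm'_bool ler0n lern1 leq_b1.
by case: b; rewrite bcons_bconst lexx ?lex_bot ?lex_top.
Qed.

Lemma char_slope_sturm a : 0 <= a < 1 -> char_slope a (sturm a a).
Proof.
move=> a01; have a01' : 0 <= a <= 1 by lra.
split=> //; first by rewrite -sturm0_bcons.
apply: (discrepancy_lex_le (a := a)) => -[|n]; first by rewrite !discrepancy0; lra.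
have := discrepancy_sturm'0 n.+1 a01'; have := discrepancy_sturm0 n.+1 a01'.
by rewrite sturm0_bcons // !discrepancy_bcons /=; lra.
Qed.

Lemma char_slope_sturm' a : 0 < a <= 1 -> char_slope a (sturm' a a).
Proof.
move=> a01; rewrite sturm'_char_flip; last lra.
rewrite -{1}(subKr 1 a).
by apply/char_slope_flip/char_slope_sturm; lra.
Qed.

Lemma char_slope_exists u : exists a, char_slope a u.
Proof.
pose slopes : set R :=
  [set b | 0 <= b <= 1 /\ (sturm' b 0 <= bcons true u)%O]%classic.
have slope0 : slopes 0.
  by split; [rewrite lexx ler01 | rewrite (sturm'_bool R false) lex_bot].
have slopes_neq0 : (slopes !=set0)%classic by exists 0.
have le_sup b : slopes b -> b <= sup slopes.
  by apply: ub_le_sup; exists 1 => c [/andP[]].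
have sup01 : 0 <= sup slopes <= 1 by rewrite le_sup // ge_sup // => b [/andP[]].
exists (sup slopes); split=> //; rewrite leNgt; apply/negP.
- move=> /(sturm0_lt_right sup01)[b b_itv]; have b01 : 0 <= b < 1 by lra.
  rewrite sturm0_bcons // bcons_lt => lt_u.
  suff : b <= sup slopes by lra.
  apply: le_sup; split; first lra.
  have [_ _ sturm'_le] := char_slope_sturm b01.
  by apply: le_trans sturm'_le _; rewrite bcons_le ltW.
- move=> /(lt_sturm'0_left sup01)[b b_itv u_lt].
  have [|c [/andP[_ c1] c_le] bc] := @sup_gt _ slopes b slopes_neq0; first lra.
  have : (sturm' b 0 <= sturm' c 0)%O by apply: sturm'0_homo; lra.
  by move=> /le_trans-/(_ _ c_le); rewrite leNgt u_lt.
Qed.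

Lemma char_slope_discrepancy_ge a u s : char_slope a u ->
  (forall k, bcons false u <= iter k shift s)%O ->
  forall n, -1 <= discrepancy a s n.
Proof.
move=> [a01 _]; apply: discrepancy_ge_lower_bound; first lra.
by move=> n; have /andP[] := discrepancy_sturm'0 n a01.
Qed.

Lemma char_slope_discrepancy_le a u s : char_slope a u ->
  (forall k, iter k shift s <= bcons true u)%O ->
  forall n, discrepancy a s n <= 1.
Proof.
move=> /char_slope_flip char_u s_le n.
have := @char_slope_discrepancy_ge _ _ (flip s) char_u _ n.
rewrite discrepancy_flip lerN2; apply => k.
by rewrite -flip_iter_shift -(flip_bcons true) flip_le.
Qed.

Lemma Sigma_sturm'0 a u s : char_slope a u -> has_slope a s ->
  Sigma (bcons false u) (sturm' a 0) s.
Proof.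
move=> [a01 le_sturm _] slope_s k; split; last exact: has_slope_le_sturm'0.
by apply: le_trans le_sturm _; apply: sturm0_le_has_slope.
Qed.

Lemma phi_char_slope a u : char_slope a u -> phi (bcons false u) = sturm' a 0.
Proof.
move=> char_u; have [a01 _ _] := char_u.
apply/eqP; rewrite eq_le; apply/andP; split.
  exact/phi_le/(Sigma_sturm'0 char_u)/has_slope_sturm'0.
apply: le_phi => y s s_in; rewrite leNgt; apply/negP.
move=> /(lt_sturm'0_left a01)[b b_itv y_lt].
have char_b : char_slope b (sturm b b) by apply: char_slope_sturm; lra.
have [_ _ sturm'_le] := char_b; suff : a <= b by lra.
apply: (@discrepancy_slope_le _ _ _ (-1) 1 s).
  by apply: char_slope_discrepancy_ge char_u _ => k; apply: (s_in k).1.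
apply: char_slope_discrepancy_le char_b _ => k.
by apply: le_trans (s_in k).2 _; apply: le_trans (ltW y_lt) sturm'_le.
Qed.

Lemma has_slope_phi a u : char_slope a u -> has_slope a (phi (bcons false u)).
Proof.
move=> char_u; have [a01 _ _] := char_u.
by rewrite (phi_char_slope char_u); apply: has_slope_sturm'0.
Qed.

Lemma Sigma_phi a u : char_slope a u ->
  Sigma (bcons false u) (phi (bcons false u)) (phi (bcons false u)).
Proof.
move=> char_u; have := has_slope_phi char_u.
by rewrite (phi_char_slope char_u); apply: Sigma_sturm'0.
Qed.

Lemma Sigma_phi_slope_eq a b u s : char_slope a u -> has_slope b s ->
  Sigma (bcons false u) (phi (bcons false u)) s -> b = a.
Proof.
move=> char_u slope_s; rewrite (phi_char_slope char_u) => s_in.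
have [_ _ sturm'_le] := char_u.
have a_ge n : -1 <= discrepancy a s n.
  by apply: char_slope_discrepancy_ge char_u _ n => k; apply: (s_in k).1.
have a_le n : discrepancy a s n <= 1.
  apply: char_slope_discrepancy_le char_u _ n => k.
  exact: le_trans (s_in k).2 sturm'_le.
have b_ge n : -1 <= discrepancy b s n.
  by have := has_slope_discrepancy 0 n slope_s; rewrite discrepancy0; lra.
have b_le n : discrepancy b s n <= 1.
  by have := has_slope_discrepancy n 0 slope_s; rewrite discrepancy0; lra.
apply/eqP; rewrite eq_le (discrepancy_slope_le b_ge a_le).
by rewrite (discrepancy_slope_le a_ge b_le).
Qed.

Lemma char_slope_inj a b u : char_slope a u -> char_slope b u -> a = b.
Proof.
move=> char_a char_b; have [a01 _ _] := char_a.
have slope_s := has_slope_sturm'0 a01.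
apply: (Sigma_phi_slope_eq char_b slope_s).
by rewrite (phi_char_slope char_a); apply: Sigma_sturm'0.
Qed.

End CharacteristicSlope.

Section SlopeArithmetic.
Variable R : realType.
Implicit Types (a : R) (u : binseq) (p q n : nat).

Lemma irrational_sturm'_char a : irrational a -> sturm' a a = sturm a a.
Proof.
move=> irr_a; have not_int n : n.+1%:R * a \isn't a Num.int.
  apply/negP => /intrP[m mE]; apply/irr_a/rationalP; exists m, n.+1.
  by rewrite -mE [_ * a]mulrC mulfK // pnatr_eq0.
apply/funext => n; rewrite /sturm' /sturm.
have mulSr m : m%:R * a + a = m.+1%:R * a by rewrite -natr1 mulrDl mul1r.
by rewrite !mulSr !ceil_floor !not_int // opprD addrACA subrr addr0.
Qed.

Lemma char_sturmian_slope u : char_sturmian R u ->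
  exists a, [/\ irrational a, char_slope a u, has_slope a u
    & sturm' a 0 = bcons true u].
Proof.
move=> [a [a01 irr_a] ->]; exists a; split=> //.
- by apply: char_slope_sturm; lra.
- by apply: has_slope_sturm_char; lra.
- by rewrite sturm'0_bcons ?irrational_sturm'_char //; lra.
Qed.

Lemma slope_pair_itv p q : slope_pair p q -> 0 < (p%:R / q%:R : R) < 1.
Proof.
move=> [p0 pq _]; have q0 : (0 : R) < q%:R by rewrite ltr0n; lia.
by rewrite ltr_pdivrMr // mul1r ltr_nat pq divr_gt0 // ltr0n.
Qed.

Lemma rational_slope_pair a : 0 < a < 1 -> rational a ->
  exists p q, slope_pair p q /\ a = p%:R / q%:R.
Proof.
move=> + [x _ xa]; rewrite -xa; case: (ratP x) => n d n_d.
rewrite fmorph_div /= ratr_int ratr_nat ltr_pdivrMr ?ltr0n // mul1r.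
rewrite pmulr_lgt0 ?invr_gt0 ?ltr0n // ltr0z => /andP[].
case: n n_d => // n n_d n0; rewrite -pmulrn ltr_nat => n_lt_d.
by exists n, d.+1.
Qed.

Lemma slope_pair_inj p q p' q' : slope_pair p q -> slope_pair p' q' ->
  p%:R / q%:R = p'%:R / q'%:R :> R -> (p, q) = (p', q').
Proof.
have ratrE m n : m%:R / n%:R = ratr (m%:Q / n%:Q) :> R.
  by rewrite fmorph_div /= !ratr_nat.
have numE m n : slope_pair m n -> numq (m%:Q / n%:Q) = m.
  by move=> [m0 mn cmn]; rewrite coprimeq_num // gtr0_sg ?mul1r //; lia.
have denE m n : slope_pair m n -> denq (m%:Q / n%:Q) = n.
  by move=> [m0 mn cmn]; rewrite coprimeq_den // gt_eqF; lia.
move=> pq pq'; rewrite !ratrE => /fmorph_inj eq_pq.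
have := denE _ _ pq; have := numE _ _ pq.
by rewrite eq_pq (numE _ _ pq') (denE _ _ pq') => -[->] [->].
Qed.

Section RationalSlope.
Variables p q : nat.
Hypothesis pq : slope_pair p q.
Local Notation a := (p%:R / q%:R : R).

Lemma sturm_char_central : sturm a a = per (central R p q ++ [:: true; false]).
Proof.
have a01 := slope_pair_itv pq.
have -> : sturm a a = shift (sturm a 0) by rewrite sturm0_bcons //; lra.
by rewrite central_lower // shift_per -cats1 -catA.
Qed.

Lemma sturm'_char_central : sturm' a a = per (central R p q ++ [:: false; true]).
Proof.
have a01 := slope_pair_itv pq.
have -> : sturm' a a = shift (sturm' a 0) by rewrite sturm'0_bcons //; lra.
by rewrite central_upper // shift_per -cats1 -catA.
Qed.

Lemma slope_pair_periodic s : has_slope a s -> iter q shift s = s.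
Proof.
apply: has_slope_periodic; rewrite mulrC divfK ?natr_int // pnatr_eq0.
by have [_ p_lt_q _] := pq; lia.
Qed.

End RationalSlope.

Lemma char_periodic_slope p q u : char_periodic R p q u ->
  char_slope (p%:R / q%:R : R) u.
Proof.
move=> [pq u_def]; have a01 := slope_pair_itv pq.
case: u_def => ->; rewrite -?sturm_char_central -?sturm'_char_central //.
  by apply: char_slope_sturm; lra.
by apply: char_slope_sturm'; lra.
Qed.

Lemma in_gap_slope p q u : in_gap R p q u -> char_slope (p%:R / q%:R : R) u.
Proof.
move=> [pq [lt_u u_lt]]; apply/(char_slopeP u (slope_pair_itv pq)).
by rewrite sturm_char_central ?sturm'_char_central // !ltW.
Qed.

Lemma in_gap_inj p q p' q' u :
  in_gap R p q u -> in_gap R p' q' u -> (p, q) = (p', q').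
Proof.
move=> gap gap'; have [[pq _] [pq' _]] := (gap, gap').
apply: slope_pair_inj pq pq' _.
exact: char_slope_inj (in_gap_slope gap) (in_gap_slope gap').
Qed.

Lemma char_slope_nonconstant a u : u <> bconst false -> u <> bconst true ->
  char_slope a u -> 0 < a < 1.
Proof.
move=> u_neq0 u_neq1 char_u; have [/andP[a0 a1] le_sturm sturm'_le] := char_u.
rewrite !lt_neqAle a0 a1 !andbT eq_sym; apply/andP; split; apply/eqP => aE.
- move: le_sturm; rewrite aE (sturm_bool R false) -(bcons_bconst false).
  rewrite bcons_le => u_le.
  by apply: u_neq0; apply/eqP; rewrite eq_le u_le lex_bot.
- move: sturm'_le; rewrite aE (sturm'_bool R true) -(bcons_bconst true).
  rewrite bcons_le => le_u.
  by apply: u_neq1; apply/eqP; rewrite eq_le le_u lex_top.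
Qed.

Lemma generic_in_gap u : generic R u -> exists p q, in_gap R p q u.
Proof.
move=> [u_neq0 u_neq1 not_sturmian not_periodic].
have [a char_u] := char_slope_exists R u.
have a01 := char_slope_nonconstant u_neq0 u_neq1 char_u.
have [ge_u le_u] := (char_slopeP u a01).1 char_u.
have rat_a : rational a.
  apply: contrapT => irr_a; apply: not_sturmian; exists a => //.
  by apply/eqP; rewrite eq_le le_u -irrational_sturm'_char.
have [p [q [pq aE]]] := rational_slope_pair a01 rat_a.
rewrite {}aE sturm_char_central ?sturm'_char_central // in ge_u le_u.
exists p, q; split=> //; rewrite !lt_neqAle ge_u le_u !andbT.
split; apply/eqP => uE; apply: not_periodic; exists p, q; split=> //.
  by right.
by left.
Qed.

Lemma char_periodic_or_generic_slope u :
  (exists p q, char_periodic R p q u) \/ generic R u ->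
  exists p q, slope_pair p q /\ char_slope (p%:R / q%:R : R) u.
Proof.
case=> [[p [q u_per]]|/generic_in_gap[p [q u_gap]]]; exists p, q.
  by split; [case: u_per | apply: char_periodic_slope].
by split; [case: u_gap | apply: in_gap_slope].
Qed.

Lemma phi_slope_pair p q u : slope_pair p q -> char_slope (p%:R / q%:R : R) u ->
  phi (bcons false u) = sturm' (p%:R / q%:R : R) 0 /\
  sturm' (p%:R / q%:R : R) 0 = per (true :: central R p q ++ [:: false]).
Proof.
by move=> pq char_u; split; [apply: phi_char_slope | apply: central_upper].
Qed.

Lemma Sigma_phi_rational p q (b : R) u s :
  slope_pair p q -> char_slope (p%:R / q%:R : R) u -> has_slope b s ->
  Sigma (bcons false u) (phi (bcons false u)) s ->
  exists j, s = iter j shift (phi (bcons false u)).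
Proof.
move=> pq char_u slope_s s_in.
have bE := Sigma_phi_slope_eq char_u slope_s s_in; rewrite {}bE in slope_s.
apply: Sigma_phi_periodic (slope_pair_periodic pq slope_s) s_in.
by case: pq; lia.
Qed.

End SlopeArithmetic.

Theorem theorem2p5 (R : realType) (u : binseq) :
  (* (i) *)
  phi (bcons true u) = bconst true
  /\
  (* (ii) *)
  (u = bconst false \/ u = bconst true -> phi (bcons false u) = u)
  /\
  (* (iii) *)
  (char_sturmian R u ->
     [/\ phi (bcons false u) = bcons true u,
         sturmian R (bcons true u),
         (forall k, (bcons false u <= iter k shift (bcons true u))%O /\
                    (iter k shift (bcons true u) <= bcons true u)%O) &
         forall s : binseq, sturmian R s ->
           (forall k, (bcons false u <= iter k shift s)%O /\
                      (iter k shift s <= bcons true u)%O) ->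
           (exists2 a : R, has_slope a u & has_slope a s) /\
           ((forall k, (iter k shift s <= s)%O) -> s = bcons true u)])
  /\
  (* (iv) *)
  (forall p q : nat, char_periodic R p q u ->
     phi (bcons false u) = sturm' (p%:R / q%:R : R) 0 /\
     sturm' (p%:R / q%:R : R) 0 = per (true :: central R p q ++ [:: false]))
  /\
  (* (v) *)
  (generic R u ->
     (exists! pq : nat * nat, in_gap R pq.1 pq.2 u) /\
     (forall p q : nat, in_gap R p q u ->
        phi (bcons false u) = sturm' (p%:R / q%:R : R) 0 /\
        sturm' (p%:R / q%:R : R) 0 = per (true :: central R p q ++ [:: false])))
  /\
  (* the final claim on cases (iv) and (v) *)
  ((exists p q : nat, char_periodic R p q u) \/ generic R u ->
     [/\ periodic_balanced R (phi (bcons false u)),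
         (forall k, (bcons false u <= iter k shift (phi (bcons false u)))%O /\
                    (iter k shift (phi (bcons false u)) <= phi (bcons false u))%O) &
         forall s : binseq, periodic_balanced R s ->
           (forall k, (bcons false u <= iter k shift s)%O /\
                      (iter k shift s <= phi (bcons false u))%O) ->
           (exists j, s = iter j shift (phi (bcons false u))) /\
           ((forall k, (iter k shift s <= s)%O) -> s = phi (bcons false u))]).
Proof.
split; first exact: phi_bcons_true.
split.
  by case=> ->; rewrite (phi_char_slope (char_slope_bconst R _)) sturm'_bool.
split.
  move=> /char_sturmian_slope[a [irr_a char_u slope_u sturm'E]].
  rewrite -sturm'E -(phi_char_slope char_u); split=> // [||s [b _ slope_s] s_in].
  - by exists a => //; apply: has_slope_phi.
  - exact: Sigma_phi char_u.
  - split; last exact: Sigma_phi_max.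
    by exists a; rewrite // -(Sigma_phi_slope_eq char_u slope_s s_in).
split.
  by move=> p q u_per; apply: phi_slope_pair (u_per.1) (char_periodic_slope u_per).
split.
  move=> /generic_in_gap[p [q gap]]; split=> [|p' q' gap'].
    by exists (p, q); split=> // -[p' q']; apply: in_gap_inj.
  exact: phi_slope_pair (gap'.1) (in_gap_slope gap').
move=> /char_periodic_or_generic_slope[p [q [pq char_u]]].
split=> [||s [b _ slope_s] s_in].
- by exists (p%:R / q%:R); [apply/rationalP; exists p, q | apply: has_slope_phi].
- exact: Sigma_phi char_u.
- split; last exact: Sigma_phi_max.
  exact: Sigma_phi_rational pq char_u slope_s s_in.
Qed.
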